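(* Let $\theta\in\mathbf{R}$, let $n\ge 3$ be an integer, and let $p(z)=z^n+e^{i\theta}z$. Then $p$ is inextensible with respect to its zero $0$, and the matrix $\mathbf{A}(p)$ (formed with respect to the zero $a=0$) is not positively singular.
   Context: $S_n$ is the set of monic complex polynomials of degree $n\ge 2$ having all their zeros in the closed unit disk $\bar D$. $Z(f)$ denotes the zero set of $f$. For $\alpha\in\mathbf{C}$ put $|p|_\alpha=\min_{w\in Z(p')}|\alpha-w|$, and put $d(p)=\max_{z\in Z(p)}\min_{w\in Z(p')}|z-w|$. Let $p\in S_n$ be such that $p$ and $p'$ have only simple zeros, and let $a$ be a zero of $p$ with $|p|_a=d(p)$ (for $p(z)=z^n+e^{i\theta}z$ one has $|p|_0=d(p)$, so $a=0$ is allowed). Write $p(z)=\prod_{i=1}^n(z-z_i)$ with $z_1=a$, and $p'(z)=n\prod_{j=1}^{n-1}(z-w_j)$, the $w_j$ being labeled so that $|w_j-a|=|p|_a$ for $1\le j\le r$ and $|w_j-a|>|p|_a$ for $j\ge r+1$. For $1\le j\le r$ set $$a_1(w_j)=-\frac{1}{w_j-a}\left[1+\frac{p(w_j)}{(w_j-a)^2p''(w_j)}\right],\qquad a_i(w_j)=-\frac{p(w_j)}{(w_j-a)(w_j-z_i)^2p''(w_j)}\quad(2\le i\le n),$$ and $b_i(w_j)=-z_i^2a_i(w_j)$ for $1\le i\le n$. Define the $r\times n$ matrices $\mathbf{A}(p)=(\alpha_{ij})$ with $\alpha_{ij}=a_j(w_i)$ and $\mathbf{B}(p)=(\beta_{ij})$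 with $\beta_{ij}=a_j(w_i)+\overline{b_j(w_i)}$, $1\le i\le r$, $1\le j\le n$. The polynomial $p$ is called extensible with respect to its zero $a$ if there exists $\vec h\in\mathbf{C}^n$ such that every component of $\Re(\mathbf{B}(p)\vec h)$ is strictly positive; otherwise $p$ is called inextensible with respect to $a$. A complex $m\times n$ matrix $\mathbf{M}=(m_{ij})$ is called positively singular if there exist real numbers $\mu_1,\ldots,\mu_m\ge 0$, not all $0$, such that $\sum_{i=1}^m\mu_im_{ij}=0$ for $1\le j\le n$. *)

(* Defs.v *)
From HB Require Import structures.
From mathcomp Require Import all_boot all_order all_algebra.
From mathcomp Require Import reals trigo complex.

Set Implicit Arguments.
Unset Strict Implicit.
Unset Printing Implicit Defensive.

Import Order.TTheory GRing.Theory Num.Theory.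
Local Open Scope ring_scope.
Local Open Scope complex_scope.

(* The complex numbers are R[i] over an arbitrary R : realType; distances are
   taken in R, through the R-valued modulus Normc.normc. *)

Section Extensibility.
Variable R : realType.
Local Notation C := R[i].
Local Notation cmod := (@Normc.normc R).

(* e^(i theta) *)
Definition cis (theta : R) : C := cos theta +i* sin theta.

(* Listed with multiplicity; Z(q) is the set of members when q != 0. *)
Definition zeros (q : {poly C}) : seq C :=
  if q == 0 then [::] else sval (closed_field_poly_normal q).

Lemma mem_zeros (q : {poly C}) (x : C) :
  q != 0 -> (x \in zeros q) = root q x.
Proof.
move=> q0; rewrite /zeros (negPf q0).
case: (closed_field_poly_normal q) => s /= ->.
by rewrite rootZ ?lead_coef_eq0 // root_prod_XsubC.
Qed.

Lemma cmodB (x y : C) : cmod (x - y) = cmod (y - x).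
Proof. by rewrite -opprB; case: (y - x) => u v; rewrite /= !sqrrN. Qed.

(* |p|_alpha. The initial value of the iterated minimum is one of its terms,
   so it does not affect the result when p' has a zero. *)
Definition crit_dist (p : {poly C}) (alpha : C) : R :=
  \big[Num.min/cmod (alpha - head 0 (zeros p^`()))]_(w <- zeros p^`())
     cmod (alpha - w).

(* d(p). The initial value 0 is harmless since moduli are nonnegative. *)
Definition max_crit_dist (p : {poly C}) : R :=
  \big[Num.max/0]_(z <- zeros p) crit_dist p z.

Definition in_S (n : nat) (p : {poly C}) : Prop :=
  [/\ (2 <= n)%N, p \is monic, size p = n.+1 &
      forall z, root p z -> cmod z <= 1].

Definition simple_zeros (q : {poly C}) : Prop :=
  forall z, root q z -> mup z q = 1%N.

(* The standing assumptions under which A(p), B(p) and extensibility with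
   respect to a are defined. *)
Definition admissible (n : nat) (p : {poly C}) (a : C) : Prop :=
  [/\ in_S n p, simple_zeros p, simple_zeros p^`(), root p a &
      crit_dist p a = max_crit_dist p].

(* Indices start at 0: the mathematical z_(i+1), w_(j+1) are z`_i, w`_j. *)
Definition labelling (n : nat) (p : {poly C}) (a : C)
    (z : n.-tuple C) (w : n.-1.-tuple C) (r : nat) : Prop :=
  [/\ p = \prod_(x <- z) ('X - x%:P),
      z`_0 = a,
      p^`() = n%:R *: \prod_(x <- w) ('X - x%:P),
      (r <= n.-1)%N &
      forall j, (j < n.-1)%N ->
        if (j < r)%N then cmod (w`_j - a) = crit_dist p a
        else crit_dist p a < cmod (w`_j - a)].

Definition coef_a (p : {poly C}) (a : C) (z : seq C) (i : nat) (w : C) : C :=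
  if i == 0%N then
    - (w - a)^-1 * (1 + p.[w] / ((w - a) ^+ 2 * p^`(2).[w]))
  else - (p.[w] / ((w - a) * (w - z`_i) ^+ 2 * p^`(2).[w])).

Definition coef_b (p : {poly C}) (a : C) (z : seq C) (i : nat) (w : C) : C :=
  - z`_i ^+ 2 * coef_a p a z i w.

Definition matA (n : nat) (p : {poly C}) (a : C)
    (z : n.-tuple C) (w : n.-1.-tuple C) (r : nat) : 'M[C]_(r, n) :=
  \matrix_(i < r, j < n) coef_a p a z j w`_i.

Definition matB (n : nat) (p : {poly C}) (a : C)
    (z : n.-tuple C) (w : n.-1.-tuple C) (r : nat) : 'M[C]_(r, n) :=
  \matrix_(i < r, j < n) (coef_a p a z j w`_i + (coef_b p a z j w`_i)^*).

(* Changing the labelling permutes the rows and columns of B(p), so it does not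
   matter which labelling is used here. *)
Definition extension_direction (n : nat) (p : {poly C}) (a : C) : Prop :=
  exists (z : n.-tuple C) (w : n.-1.-tuple C) (r : nat),
    labelling p a z w r /\
    exists h : 'cV[C]_n, forall i, 0 < complex.Re ((matB p a z w r *m h) i 0).

Definition extensible (n : nat) (p : {poly C}) (a : C) : Prop :=
  admissible n p a /\ extension_direction n p a.

Definition inextensible (n : nat) (p : {poly C}) (a : C) : Prop :=
  admissible n p a /\ ~ extension_direction n p a.

Definition positively_singular (m n : nat) (M : 'M[C]_(m, n)) : Prop :=
  exists mu : 'I_m -> R,
    [/\ forall i, 0 <= mu i, exists i, mu i != 0 &
        forall j, \sum_i (mu i)%:C * M i j = 0].

(* Labellings always exist, so quantifying over them is never vacuous. *)
Lemma labelling_exists (n : nat) (p : {poly C}) (a : C) :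
  admissible n p a ->
  exists (z : n.-tuple C) (w : n.-1.-tuple C) (r : nat), labelling p a z w r.
Proof.
case=> -[n2 pmon szp _] _ _ rootpa _.
have p0 : p != 0 by rewrite monic_neq0.
have zerosE q : q != 0 -> q = lead_coef q *: \prod_(x <- zeros q) ('X - x%:P).
  by move=> q0; rewrite /zeros (negPf q0); case: closed_field_poly_normal.
have size_zeros q : q != 0 -> size (zeros q) = (size q).-1.
  move=> q0; have /(congr1 (fun P : {poly C} => size P)) := zerosE q q0.
  by rewrite size_scale ?lead_coef_eq0 // size_prod_XsubC => ->.
have coefp' : p^`()`_n.-1 = n%:R.
  rewrite coef_deriv prednK ?(ltn_trans _ n2) //.
  by have := monicP pmon; rewrite lead_coefE szp /= => ->.
have nn0 : n%:R != 0 :> C by rewrite pnatr_eq0 -lt0n (ltn_trans _ n2).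
have p'0 : p^`() != 0.
  by apply: contra nn0 => /eqP p'0; rewrite -coefp' p'0 coef0.
have szp' : size p^`() = n.
  apply/eqP; rewrite eqn_leq -{1}[n]/(n.+1.-1) -szp; apply/andP; split.
    by rewrite -ltnS (leq_trans (lt_size_deriv p0)) // szp.
  rewrite -(@prednK n) ?(ltn_trans _ n2) // ltnNge; apply/negP => /leq_sizeP.
  by move=> /(_ _ (leqnn _))/eqP; rewrite coefp' (negPf nn0).
have pz : perm_eq (zeros p) (a :: rem a (zeros p)).
  by apply: perm_to_rem; rewrite mem_zeros.
pose P w := cmod (w - a) == crit_dist p a.
pose ws := [seq x <- zeros p^`() | P x] ++ [seq x <- zeros p^`() | ~~ P x].
have pw : perm_eq ws (zeros p^`()) by rewrite /ws perm_filterC.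
have szz : size (a :: rem a (zeros p)) == n.
  by rewrite -(perm_size pz) size_zeros // szp.
have szw : size ws == n.-1 by rewrite (perm_size pw) size_zeros // szp'.
exists (Tuple szz), (Tuple szw), (size [seq x <- zeros p^`() | P x]).
split => //.
- rewrite /= {1}(zerosE p p0) (monicP pmon) scale1r.
  by apply: perm_big.
- rewrite /= {1}(zerosE _ p'0) lead_coefE szp' coefp'.
  by congr (_ *: _); apply: perm_big; rewrite perm_sym.
- by rewrite -(eqP szw) size_cat leq_addr.
move=> j jn; rewrite /= /ws nth_cat.
have [jr|jr] := ltnP j (size [seq x <- zeros p^`() | P x]).
  by have := mem_nth 0 jr; rewrite mem_filter => /andP[/eqP].
have kr : (j - size [seq x <- zeros p^`() | P x] <
           size [seq x <- zeros p^`() | ~~ P x])%N.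
  by move: jn; rewrite -(eqP szw) size_cat ltn_subLR.
have := mem_nth 0 kr; rewrite mem_filter => /andP[nP inz].
rewrite lt_neqAle eq_sym nP andTb.
rewrite cmodB /crit_dist.
exact: ge_bigmin_seq.
Qed.

End Extensibility.

(* Main.v *)
Require Import Defs.
From HB Require Import structures.
From mathcomp Require Import all_boot all_order all_algebra.
From mathcomp Require Import reals trigo complex.
From mathcomp Require Import ring lra.
Import Order.TTheory GRing.Theory Num.Theory.
Local Open Scope ring_scope.
Local Open Scope complex_scope.

(* Put m = n - 1 and c = e^(i theta). The critical points w of p are the roots of
   w^m = -c/n, all of the same modulus n^(-1/m), and the nonzero zeros of p are
   the roots of z^m = -c. Since p(w)/p''(w) = -w^2/n, the entries of A(p) are
   a_1(w) = -(m/n)/w and a_j(w) = w/(n (w - z_j)^2). Differentiating the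
   logarithmic derivative of X^m - e evaluates both sums
     sum_w a_j(w) = 1/z_j    and    sum_j z_j a_j(w) = 1.
   As |z_j| = 1, the first gives sum_w (a_j(w) + conj(b_j(w)))
   = 1/z_j - conj(z_j) = 0, so the rows of B(p) sum to zero and Re(B(p) h) cannot
   have all its components positive. By the second, a nonnegative combination
   mu of the rows of A(p) that vanishes satisfies sum_i mu_i = 0, so mu = 0. *)

(** * Logarithmic derivatives of a split monic polynomial *)

Lemma horner_deriv_prod_XsubC (F : fieldType) (s : seq F) (x : F) :
  x \notin s ->
  (\prod_(w <- s) ('X - w%:P))^`().[x] =
  (\prod_(w <- s) ('X - w%:P)).[x] * \sum_(w <- s) (x - w)^-1.
Proof.
elim: s => [|w s IHs]; first by rewrite !big_nil derivC horner0 mulr0.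
rewrite inE negb_or => /andP[xw xs].
have xw0 : x - w != 0 by rewrite subr_eq0.
by rewrite !big_cons !derivE !hornerE IHs //; field.
Qed.

(** With [q] the product, this is q''/q = (q'/q)^2 + (q'/q)'. *)
Lemma horner_deriv2_prod_XsubC (F : fieldType) (s : seq F) (x : F) :
  x \notin s ->
  (\prod_(w <- s) ('X - w%:P))^`()^`().[x] =
  (\prod_(w <- s) ('X - w%:P)).[x] *
    ((\sum_(w <- s) (x - w)^-1) ^+ 2 - \sum_(w <- s) (x - w)^-1 ^+ 2).
Proof.
elim: s => [|w s IHs].
  by rewrite !big_nil !derivC horner0 expr0n subrr mulr0.
rewrite inE negb_or => /andP[xw xs].
have xw0 : x - w != 0 by rewrite subr_eq0.
rewrite !big_cons !derivE !hornerE IHs // horner_deriv_prod_XsubC //.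
by rewrite /=; field.
Qed.

(** * Two sums over the roots of X^m - e *)

Section RootsOfXnsubC.
Variables (F : fieldType) (m : nat) (e x : F) (s : seq F).
Hypothesis m_gt1 : (1 < m)%N.
Hypothesis sE : \prod_(w <- s) ('X - w%:P) = 'X^m - e%:P.
Hypothesis xm : x ^+ m != e.

Lemma mem_roots_XnsubC w : (w \in s) = (w ^+ m == e).
Proof. by rewrite -root_prod_XsubC sE /root !hornerE subr_eq0. Qed.

Lemma sum_roots_inv :
  \sum_(w <- s) (x - w)^-1 = m%:R * x ^+ m.-1 / (x ^+ m - e).
Proof.
have xs : x \notin s by rewrite mem_roots_XnsubC.
have := @horner_deriv_prod_XsubC F s x xs.
rewrite sE !derivE subr0 hornerMn !hornerE.
by rewrite -mulr_natl => ->; rewrite mulrC mulKf // subr_eq0.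
Qed.

(* Minus the derivative of x q'(x)/q(x), where q = X^m - e. *)
Lemma sum_roots_sqr :
  \sum_(w <- s) w / (w - x) ^+ 2 =
  m%:R ^+ 2 * e * x ^+ m.-1 / (x ^+ m - e) ^+ 2.
Proof.
have xs : x \notin s by rewrite mem_roots_XnsubC.
have := @horner_deriv2_prod_XsubC F s x xs.
(* Writing w = x - (x - w) splits each term. *)
have -> : \sum_(w <- s) w / (w - x) ^+ 2 =
    x * (\sum_(w <- s) (x - w)^-1 ^+ 2) - \sum_(w <- s) (x - w)^-1.
  rewrite mulr_sumr -sumrB; apply: eq_big_seq => w ws.
  have xw : x - w != 0 by rewrite subr_eq0; apply: contraNneq xs => ->.
  have wx : w - x != 0 by rewrite -opprB oppr_eq0.
  by field; rewrite wx xw.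
rewrite sum_roots_inv sE !derivE !hornerE subr0 -mulrnA hornerMn hornerXn.
(* Setting m = k + 2 makes the exponents m - 1 and m - 2 of q' and q'' explicit. *)
case: m m_gt1 xm => [|[|k]] // _ xk; rewrite /= -mulr_natl natrM => h.
have q0 : x ^+ k.+2 - e != 0 by rewrite subr_eq0.
have -> : \sum_(w <- s) (x - w)^-1 ^+ 2 =
    (k.+2%:R * x ^+ k.+1 / (x ^+ k.+2 - e)) ^+ 2
    - k.+1%:R * k.+2%:R * x ^+ k / (x ^+ k.+2 - e).
  by rewrite h [X in _ = _ - X]mulrC mulKf // opprB addrC subrK.
move: q0; rewrite -![k.+2%:R]natr1 -[k.+1%:R]natr1 !exprS => q0; by field.
Qed.

End RootsOfXnsubC.

(** A factor (X - x)^2 of [q] would leave a factor X - x in q'. *)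
Lemma mup_simple (F : fieldType) (q : {poly F}) (x : F) :
  root q x -> ~~ root q^`() x -> mup x q = 1%N.
Proof.
move=> qx q'x.
have q0 : q != 0 by apply: contraNneq q'x => ->; rewrite derivC root0.
apply/eqP; rewrite eqn_leq -XsubC_dvd // dvdp_XsubCl qx andbT.
rewrite mup_leq //; apply: contra q'x => /dvdpP[s ->]; apply/rootP.
by rewrite !derivE !hornerE /=; ring.
Qed.

Lemma normc_ge0 (R : rcfType) (x : R[i]) : 0 <= Normc.normc x.
Proof. by case: x => a b; apply: sqrtr_ge0. Qed.

Lemma normcX (R : rcfType) (x : R[i]) k :
  Normc.normc (x ^+ k) = Normc.normc x ^+ k.
Proof. by apply: complexI; rewrite rmorphXn; apply: (normrX k x). Qed.

Lemma normc_nat (R : rcfType) k : Normc.normc k%:R = k%:R :> R.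
Proof.
by apply: complexI; rewrite rmorph_nat; apply: (normr_nat R[i] k).
Qed.

(** * Zeros and critical points of the trinomial, and admissibility *)

Section Trinomial.
Variables (R : realType) (m : nat) (c : R[i]).
Hypothesis m_gt1 : (1 < m)%N.
Hypothesis c_unit : Normc.normc c = 1.
Local Notation cmod := (@Normc.normc R).
Local Notation p := (('X^(m.+1) + c%:P * 'X) : {poly R[i]}).

Let m_gt0 : (0 < m)%N := ltnW m_gt1.

Lemma c_neq0 : c != 0.
Proof.
apply/eqP => c0; move: c_unit (oner_neq0 R).
by rewrite c0 Normc.normc0 => <-; rewrite eqxx.
Qed.

Lemma horner_trinomial x : p.[x] = x * (x ^+ m + c).
Proof. by rewrite !hornerE exprS mulrDr [x * c]mulrC. Qed.

Lemma deriv_trinomial : p^`() = m.+1%:R *: ('X^m - (- c / m.+1%:R)%:P).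
Proof.
rewrite !derivE /= mulr1 scalerBr scaler_nat -[_ *: _%:P]mul_polyC.
by rewrite -polyCM mulNr mulrN mulrC divfK ?pnatr_eq0 // polyCN opprK.
Qed.

Lemma horner_deriv2_trinomial x : p^`(2).[x] = m.+1%:R * m%:R * x ^+ m.-1.
Proof.
rewrite /= deriv_trinomial !derivE subr0 hornerZ hornerMn hornerXn.
by rewrite -[_ *+ m]mulr_natl mulrA.
Qed.

Lemma root_trinomial x : root p x = (x == 0) || (x ^+ m == - c).
Proof. by rewrite /root horner_trinomial mulf_eq0 addr_eq0. Qed.

Lemma root_deriv_trinomial w : root p^`() w = (w ^+ m == - c / m.+1%:R).
Proof.
by rewrite deriv_trinomial rootZ ?pnatr_eq0 // /root !hornerE subr_eq0.
Qed.

Lemma size_trinomial : size p = m.+2.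
Proof.
rewrite size_polyDl size_polyXn // mul_polyC.
by rewrite (leq_ltn_trans (size_scale_leq _ _)) // size_polyX.
Qed.

Lemma trinomial_monic : p \is monic.
Proof.
rewrite monicE lead_coefDl ?lead_coefXn // size_polyXn mul_polyC.
by rewrite (leq_ltn_trans (size_scale_leq _ _)) // size_polyX.
Qed.

Lemma cmod_root z : z ^+ m = - c -> cmod z = 1.
Proof.
move=> zm; apply/eqP; rewrite -(@pexpr_eq1 _ _ m) ?normc_ge0 //.
by rewrite -normcX zm normcN c_unit.
Qed.

Lemma cmod_crit w : w ^+ m = - c / m.+1%:R -> cmod w ^+ m = m.+1%:R^-1.
Proof.
move=> wm; rewrite -normcX wm Normc.normcM normcN c_unit mul1r.
by rewrite Normc.normcV normc_nat.
Qed.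

Lemma crit_exists : exists w, w ^+ m = - c / m.+1%:R.
Proof.
have [|w] := closed_rootP ('X^m - (- c / m.+1%:R)%:P : {poly R[i]}) _.
  by rewrite size_XnsubC //; case: m m_gt0.
by rewrite /root !hornerE subr_eq0 => /eqP wm; exists w.
Qed.

Lemma cmod_crit_eq v w :
  v ^+ m = - c / m.+1%:R -> w ^+ m = - c / m.+1%:R -> cmod v = cmod w.
Proof.
move=> /cmod_crit vm /cmod_crit wm; apply/eqP.
by rewrite -(@eqrXn2 _ m) ?normc_ge0 // vm wm.
Qed.

(** Follows from |w|^m = 1/(m+1) and m + 1 <= 2^m. The bound 1/2 serves to get 1 - |w| <= |w|. *)
Lemma crit_radius_bounds w :
  w ^+ m = - c / m.+1%:R -> 2^-1 <= cmod w <= 1.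
Proof.
move=> /cmod_crit wm; apply/andP; split.
  rewrite -(@ler_pXn2r _ m) ?nnegrE ?normc_ge0 ?invr_ge0 // wm exprVn -natrX.
  by rewrite lef_pV2 ?posrE ?ltr0n ?expn_gt0 // ler_nat ltn_expl.
rewrite -(@ler_pXn2r _ m) ?nnegrE ?normc_ge0 // wm expr1n.
by rewrite invf_le1 ?ltr0n // ler1n.
Qed.

Let nz : m.+1%:R != 0 :> R[i]. Proof. by rewrite pnatr_eq0. Qed.
Let mz : m%:R != 0 :> R[i]. Proof. by rewrite pnatr_eq0 -lt0n. Qed.

Lemma expr0_neq_crit : 0 ^+ m != - c / m.+1%:R.
Proof.
rewrite expr0n gtn_eqF // eq_sym mulf_eq0 invr_eq0 oppr_eq0.
by rewrite (negPf c_neq0) (negPf nz).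
Qed.

Lemma crit_neq0 v : v ^+ m = - c / m.+1%:R -> v != 0.
Proof. by move=> vm; apply: contraNneq expr0_neq_crit => <-; rewrite vm. Qed.

(** Keeps the zeros of [p] apart from those of p': equality would force m + 1 = 1. *)
Lemma crit_not_root : - c / m.+1%:R != - c.
Proof.
rewrite -subr_eq0 -[X in _ - X]mulr1 -mulrBr mulf_eq0 oppr_eq0.
rewrite (negPf c_neq0) subr_eq0 /= -(inj_eq (@invr_inj _)) invr1 invrK.
by rewrite -[1]/(1%:R) eqr_nat eqSS gtn_eqF.
Qed.

Lemma deriv_trinomial_neq0 : p^`() != 0.
Proof.
apply/negP => /eqP p'0; have := root_deriv_trinomial 0.
by rewrite p'0 root0 (negPf expr0_neq_crit).
Qed.

Lemma mem_zeros_deriv w : (w \in zeros p^`()) = (w ^+ m == - c / m.+1%:R).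
Proof. by rewrite mem_zeros ?deriv_trinomial_neq0 // root_deriv_trinomial. Qed.

Lemma crit_dist0 w : w ^+ m = - c / m.+1%:R -> crit_dist p 0 = cmod w.
Proof.
move=> wm.
have E v : v \in zeros p^`() -> cmod (0 - v) = cmod w.
  by rewrite mem_zeros_deriv sub0r normcN => /eqP vm; apply: cmod_crit_eq.
have w_in : w \in zeros p^`() by rewrite mem_zeros_deriv wm.
(* The initial value of the minimum is itself one of the equal distances, since the list of critical
   points is nonempty. *)
rewrite /crit_dist E; last by case: zeros w_in => // v s _; rewrite mem_head.
by rewrite big_seq bigmin_eq_id // => v /E ->.
Qed.

(* The critical point on the ray through a nonzero zero z of p is at distance
   1 - |w| from z. *)
Lemma crit_dist_root_le z w :
  z ^+ m = - c -> w ^+ m = - c / m.+1%:R -> crit_dist p z <= cmod w.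
Proof.
move=> zm wm; have /andP[w_ge w_le] := @crit_radius_bounds w wm.
pose v := z * (cmod w)%:C.
have v_in : v \in zeros p^`().
  rewrite mem_zeros_deriv exprMn zm -rmorphXn cmod_crit //.
  by rewrite fmorphV rmorph_nat.
rewrite /crit_dist; apply: (le_trans (ge_bigmin_seq _ _ _ _ v_in _)) => //.
have -> : z - v = z * (1 - cmod w)%:C by rewrite rmorphB mulrBr mulr1.
rewrite Normc.normcM cmod_root // mul1r /= expr0n addr0 sqrtr_sqr.
by rewrite ger0_norm ?subr_ge0 //; lra.
Qed.

Lemma trinomial_admissible : admissible m.+1 p 0.
Proof.
have [w wm] := crit_exists.
have p0 : p != 0 by rewrite monic_neq0 ?trinomial_monic.
split.
- split; rewrite ?trinomial_monic ?size_trinomial //.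
  move=> z; rewrite root_trinomial => /orP[/eqP ->|/eqP zm].
    by rewrite Normc.normc0.
  by rewrite cmod_root.
- move=> z; rewrite root_trinomial => pz.
  apply: mup_simple; first by rewrite root_trinomial.
  rewrite root_deriv_trinomial; case/orP: pz => /eqP ->.
    exact: expr0_neq_crit.
  by rewrite eq_sym crit_not_root.
- move=> v pv; apply: mup_simple => //.
  rewrite -/(p^`(2)) /root horner_deriv2_trinomial !mulf_eq0.
  rewrite (negPf nz) (negPf mz).
  move: pv; rewrite root_deriv_trinomial => /eqP/crit_neq0 v0.
  by rewrite expf_eq0 (negPf v0) andbF.
- by rewrite root_trinomial eqxx.
(* d(p) = |w|: one inequality holds because 0 is a zero of [p], the other because no zero is farther
   than |w| from the critical points. *)
rewrite (@crit_dist0 w wm); apply/eqP; rewrite eq_le; apply/andP; split.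
  rewrite -(@crit_dist0 w wm); apply: (le_bigmax_seq _ _ predT) => //.
  by rewrite mem_zeros // root_trinomial eqxx.
rewrite /max_crit_dist big_seq; apply: bigmax_le; first exact: normc_ge0.
move=> z; rewrite mem_zeros // root_trinomial => /orP[/eqP ->|/eqP zm].
  by rewrite (@crit_dist0 w wm).
exact: crit_dist_root_le.
Qed.

(** * Entries of A(p) at a critical point *)

Lemma expr_pred (x : R[i]) : x != 0 -> x ^+ m.-1 = x ^+ m / x.
Proof. by move=> x0; rewrite -[in RHS](prednK m_gt0) exprSr mulfK. Qed.

(** Here c = -(m+1) v^m, so p(v) = -m v^(m+1), while p''(v) = (m+1) m v^(m-1). *)
Lemma horner_ratio_crit v :
  v ^+ m = - c / m.+1%:R -> p.[v] / p^`(2).[v] = - v ^+ 2 / m.+1%:R.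
Proof.
move=> vm; rewrite horner_trinomial horner_deriv2_trinomial vm.
have v0 := crit_neq0 _ vm.
have -> : v ^+ m.-1 = - c / m.+1%:R / v.
  by rewrite expr_pred // vm.
have := nz; rewrite -natr1 => nz1; have c0 := c_neq0.
by field; rewrite v0 mz nz1 c0.
Qed.

(** The factor [(0 - v)^-1] is kept in the shape of [sum_roots_inv] at x = 0. *)
Lemma coef_a0 z v : v ^+ m = - c / m.+1%:R ->
  coef_a p 0 z 0 v = m%:R / m.+1%:R * (0 - v)^-1.
Proof.
move=> vm; rewrite /coef_a eqxx subr0 invfM mulrCA horner_ratio_crit //.
have v0 := crit_neq0 _ vm.
have := nz; rewrite sub0r invrN -natr1 => nz1.
by field; rewrite v0 nz1.
Qed.

Lemma coef_aE z j v : (0 < j)%N -> v ^+ m = - c / m.+1%:R ->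
  coef_a p 0 z j v = m.+1%:R^-1 * (v / (v - z`_j) ^+ 2).
Proof.
move=> j0 vm; rewrite /coef_a gtn_eqF // subr0 invfM mulrCA.
rewrite horner_ratio_crit //.
have v0 := crit_neq0 _ vm.
(* Abstracting the inverse square spares [field] the condition that [v] differs from z_j. *)
rewrite invfM; move: (_ ^+ 2)^-1 => d.
have := nz; rewrite -natr1 => nz1.
by field; rewrite v0 nz1.
Qed.

(** * Row and column sums for a given labelling *)

Section Labelled.
Variables (z : m.+1.-tuple R[i]) (w : m.-tuple R[i]) (r : nat).
Hypothesis zw : @labelling R m.+1 p 0 z w r.

(** Since z_0 = 0, the factor X cancels from p = X (X^m + c). *)
Lemma labelling_roots : \prod_(x <- behead z) ('X - x%:P) = 'X^m - (- c)%:P.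
Proof.
case: zw => pE z0 _ _ _; have X0 : 'X != 0 :> {poly R[i]} by rewrite polyX_eq0.
apply: (mulfI X0); move: pE z0; case: z => -[//|x s] /= _ pE x0.
rewrite big_cons x0 subr0 in pE.
by rewrite -pE polyCN opprK mulrDr exprS [c%:P * _]mulrC.
Qed.

Lemma labelling_crits :
  \prod_(x <- w) ('X - x%:P) = 'X^m - (- c / m.+1%:R)%:P.
Proof.
by case: zw => _ _; rewrite deriv_trinomial => /scalerI ->.
Qed.

Lemma crit_nth i : (i < m)%N -> w`_i ^+ m = - c / m.+1%:R.
Proof.
move=> im; apply/eqP; rewrite -(mem_roots_XnsubC _ _ _ _ labelling_crits).
by rewrite mem_nth // size_tuple.
Qed.

Lemma root_nth j : (0 < j < m.+1)%N -> z`_j ^+ m = - c.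
Proof.
case: j => // j /=; rewrite ltnS => jm; apply/eqP.
rewrite -(mem_roots_XnsubC _ _ _ _ labelling_roots).
by rewrite -nth_behead mem_nth // size_behead size_tuple.
Qed.

(** All critical points are equally far from 0, so an index [r] below [m] would give a strict
    inequality between equal moduli. *)
Lemma labelling_all_crits : r = m.
Proof.
case: zw => _ _ _ /= rm /(_ r); have [//|r_neq] := eqVneq r m.
have r_lt : (r < m)%N by rewrite ltn_neqAle r_neq.
move/(_ r_lt); rewrite ltnn subr0 (@crit_dist0 w`_r) ?ltxx //.
exact: crit_nth.
Qed.

Lemma sum_crits (f : R[i] -> R[i]) :
  \sum_(i < m) f w`_i = \sum_(v <- w) f v.
Proof. by rewrite (big_nth 0) size_tuple big_mkord. Qed.

(** The sum is a multiple of the logarithmic derivative of X^m + c/(m+1) at 0, which vanishes as m >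
    1. *)
Lemma sum_coef_a0 : \sum_(i < m) coef_a p 0 z 0 w`_i = 0.
Proof.
under eq_bigr => i _ do rewrite coef_a0 ?crit_nth //.
rewrite -mulr_sumr (sum_crits (fun v => (0 - v)^-1)).
rewrite (sum_roots_inv _ _ _ _ _ labelling_crits) ?expr0_neq_crit //.
by rewrite expr0n gtn_eqF ?mulr0 ?mul0r ?mulr0 // -subn1 subn_gt0.
Qed.

Lemma sum_coef_a j : (0 < j < m.+1)%N ->
  \sum_(i < m) coef_a p 0 z j w`_i = (z`_j)^-1.
Proof.
move=> jm; have /andP[j0 _] := jm; have zm := root_nth j jm.
under eq_bigr => i _ do rewrite coef_aE ?crit_nth //.
rewrite -mulr_sumr (sum_crits (fun v => v / (v - z`_j) ^+ 2)).
have zNcrit : z`_j ^+ m != - c / m.+1%:R by rewrite zm eq_sym crit_not_root.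
rewrite (sum_roots_sqr _ _ _ _ _ _ labelling_crits) //.
have z0 : z`_j != 0.
  apply/eqP => z0; move: zm; rewrite z0 expr0n gtn_eqF // => /eqP.
  by rewrite eq_sym oppr_eq0 (negPf c_neq0).
have -> : z`_j ^+ m.-1 = - c / z`_j.
  by rewrite expr_pred // zm.
have := nz; rewrite zm -natr1 => nz1; have c0 := c_neq0.
field; rewrite z0 nz1 [X in X != 0](_ : _ = - (c * m%:R)); last by ring.
by rewrite oppr_eq0 mulf_neq0.
Qed.

(** The roles are exchanged with respect to [sum_coef_a]: the sum runs over the roots of X^m + c,
    and x is the critical point [v]. *)
Lemma sum_root_coef_a v : v ^+ m = - c / m.+1%:R ->
  \sum_(j < m) z`_j.+1 * coef_a p 0 z j.+1 v = 1.
Proof.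
move=> vm.
under eq_bigr => j _.
  rewrite coef_aE // mulrCA [X in _ * X]mulrCA mulrA; over.
rewrite -mulr_sumr.
have -> : \sum_(j < m) z`_j.+1 / (v - z`_j.+1) ^+ 2
  = \sum_(x <- behead z) x / (x - v) ^+ 2.
  rewrite (big_nth 0) size_behead size_tuple big_mkord.
  by apply: eq_bigr => j _; rewrite nth_behead -[X in _ / X]sqrrN opprB.
have vNroot : v ^+ m != - c by rewrite vm crit_not_root.
rewrite (sum_roots_sqr _ _ _ _ _ _ labelling_roots) //.
have v0 := crit_neq0 _ vm.
have -> : v ^+ m.-1 = - c / m.+1%:R / v.
  by rewrite expr_pred // vm.
have := nz; rewrite vm -natr1 => nz1; have c0 := c_neq0.
field; rewrite v0 nz1 [X in X != 0](_ : _ = c * m%:R); last by ring.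
by rewrite mulf_neq0.
Qed.

Lemma matB_rows_sum0 j : \sum_i matB p 0 z w r i j = 0.
Proof.
(* The matrix type depends on [r], so [r] is replaced by [m] only in sums of functions on [nat]. *)
have rank_m (f : nat -> R[i]) : \sum_(i < r) f i = \sum_(i < m) f i.
  by rewrite labelling_all_crits.
under eq_bigr => i _ do rewrite mxE.
rewrite (rank_m (fun i => coef_a p 0 z j w`_i + (coef_b p 0 z j w`_i)^*)).
rewrite big_split -rmorph_sum -mulr_sumr /=.
have [j0|j0] := posnP j.
  by rewrite j0 sum_coef_a0 mulr0 rmorph0 addr0.
have jm : (0 < j < m.+1)%N by rewrite j0 ltn_ord.
rewrite sum_coef_a //.
have z1 : cmod z`_j = 1 by apply/cmod_root/root_nth.
have z0 : z`_j != 0.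
  by apply/eqP => z0; move/eqP: z1; rewrite z0 Normc.normc0 eq_sym oner_eq0.
(* What remains is 1/z_j - conj(z_j), and 1/z_j = conj(z_j) / |z_j|^2. *)
rewrite expr2 mulNr mulfK // rmorphN /= invc_norm.
have -> : `|z`_j| = 1 by rewrite -[LHS]/((cmod z`_j)%:C) z1.
by rewrite expr1n invr1 mul1r subrr.
Qed.

End Labelled.

(** * Inextensibility and failure of positive singularity *)

Lemma no_extension_direction : ~ @extension_direction R m.+1 p 0.
Proof.
case=> z [w [r [zw [h h_gt0]]]].
have r_m := labelling_all_crits z w r zw.
pose B := matB p 0 z w r.
have : \sum_i (B *m h) i 0 = 0.
  under eq_bigr => i _ do rewrite mxE.
  rewrite exchange_big big1 // => j _ /=.
  by rewrite -mulr_suml (matB_rows_sum0 z w r zw) mul0r.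
move/(congr1 (@complex.Re R)).
rewrite (raddf_sum (@complex.Re R : Rcomplex R -> R)) /=.
apply/eqP; rewrite gt_eqF //.
(* At least one row is needed for the sum of positive real parts to be nonzero. *)
have r0 : (0 < r)%N by rewrite r_m.
rewrite (bigD1 (Ordinal r0)) //= ltr_wpDr //.
by apply: sumr_ge0 => i _; apply: ltW.
Qed.

Lemma matA_not_singular (z : m.+1.-tuple R[i]) (w : m.-tuple R[i]) r :
  @labelling R m.+1 p 0 z w r ->
  ~ positively_singular (matA (n := m.+1) p 0 z w r).
Proof.
move=> zw [mu [mu_ge0 [i0 mu_i0] mu_A]].
have r_m := labelling_all_crits z w r zw.
(* The vanishing combination is paired with the vector of nonzero zeros; column 0 would contribute
   nothing, as z_0 = 0. *)
have : \sum_(j < m) z`_j.+1 *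
    (\sum_i (mu i)%:C * matA (n := m.+1) p 0 z w r i (lift ord0 j)) = 0.
  by rewrite big1 // => j _; rewrite mu_A mulr0.
under eq_bigr => j _ do rewrite mulr_sumr.
rewrite exchange_big /= (eq_bigr (fun i => (mu i)%:C)) => [|i _]; last first.
  under eq_bigr => j _ do rewrite mxE mulrCA.
  rewrite -mulr_sumr (sum_root_coef_a z w r zw) ?mulr1 //.
  by apply: (crit_nth z w r zw); rewrite -r_m.
rewrite -rmorph_sum => /complexI/eqP; rewrite psumr_eq0 // => /allP/(_ i0).
by rewrite mem_index_enum (negPf mu_i0) => /(_ isT).
Qed.

End Trinomial.

Lemma cmod_cis (R : realType) (theta : R) : Normc.normc (cis theta) = 1.
Proof. by rewrite /= cos2Dsin2 sqrtr1. Qed.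

Theorem proposition1p2 (R : realType) (theta : R) (n : nat) (hn : (3 <= n)%N) :
  let p : {poly R[i]} := 'X^n + (cis theta)%:P * 'X in
  inextensible n p 0 /\
  (forall (z : n.-tuple R[i]) (w : n.-1.-tuple R[i]) (r : nat),
     labelling p 0 z w r ->
  ~ positively_singular (matA p 0 z w r)).
Proof.
(* With n = m + 1, the bound n >= 3 becomes m > 1. *)
case: n hn => // m m_gt1; have c_unit := cmod_cis _ theta; split; first split.
- exact: trinomial_admissible.
- exact: no_extension_direction.
- exact: matA_not_singular.
Qed.
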